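(* Let $m\ge1$ be an integer and $\tau>0$ a time step, with the discretization matrices and discrete inner product defined in the context. The scheme $$\frac{\mathbf{u}^{n+1}-\mathbf{u}^n}{\tau}=\mathbf{P}^{-1}\mathbf{F}^{-1}\mathbf{H}\mathbf{S}_2\mathbf{F}\mathbf{P}\,\mathbf{u}^{n+\frac12}-\frac{1}{m+1}\Big(\mathrm{diag}\big((\mathbf{u}^{n+\frac12})^{\mathbf{m-1}}\big)\mathbf{P}^{-1}\mathbf{F}^{-1}\mathbf{S}_1\mathbf{F}\mathbf{P}\,\mathbf{u}^{n+\frac12}+\mathbf{P}^{-1}\mathbf{F}^{-1}\mathbf{S}_1\mathbf{F}\mathbf{P}\,(\mathbf{u}^{n+\frac12})^{\mathbf m}\Big),$$ where $\mathbf u^{n+\frac12}=\frac12(\mathbf u^n+\mathbf u^{n+1})$, conserves the discrete mass $M_h^n=\langle\mathbf u^n,\mathbf u^n\rangle_h$ exactly in time: if real grid vectors $\mathbf u^n,\mathbf u^{n+1}$ satisfy the scheme, then $$M_h^{n+1}=M_h^n.$$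
   Context: The scheme discretizes the generalized Benjamin-Ono equation $u_t=-(-\mathcal H u_x+\frac1m u^m)_x$ on $\mathbb R$, $u$ real-valued, $\mathcal H$ the Hilbert transform; $\mathbf u^n$ approximates $u(x_j,n\tau)$. Discretization. Let $\alpha>0$, $N$ a positive even integer, $J=\{-N/2,\dots,N/2-1\}$; vectors and matrices are indexed by $J$. Put $\theta_j=2\pi j/N$, $x_j=\alpha\tan(\theta_j/2)$, so $x_{-N/2}=-\infty$. Define: - $\mathbf F_{kj}=\frac1N e^{-ik\theta_j}$ and $(\mathbf F^{-1})_{jk}=e^{ik\theta_j}$ (discrete Fourier matrix and its inverse); - $\mathbf P=\mathrm{diag}(\alpha-ix_j)_{j\in J}$ and $\mathbf W=\mathbf P\overline{\mathbf P}=\mathrm{diag}(w_j)$, $w_j=\alpha^2+x_j^2$; - $\mathbf S_1$ the tridiagonal matrix $(\mathbf S_1\hat{\mathbf u})_k=\frac{i}{2\alpha}\big[k\hat u_{k-1}+(2k+1)\hat u_k+(k+1)\hat u_{k+1}\big]$, where $\hat u_{k}:=0$ for $k\notin J$; $\mathbf S_2=\mathbf S_1\mathbf S_1$; - $\mathbf H=-i\,\mathrm{diag}(\mathrm{sgn}(k+\tfrac12))_{k\in J}$. Boundary convention at the node $x_{-N/2}=-\infty$: all grid vectors $\mathbf u=(u_j)_{j\in J}$ satisfy $u_{-N/2}=0$, and this node contributes nothing; i.e. the $-N/2$ diagonal entries of $\mathbf P$, $\mathbf P^{-1}$ and $\mathbf W$ are read as $0$ (the other diagonal entries of $\mathbf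 P^{-1}$ are $1/(\alpha-ix_j)$). The discrete inner product is $\langle\mathbf u,\mathbf v\rangle_h=\frac{\pi}{N\alpha}\overline{\mathbf v}^T\mathbf W\mathbf u=\frac{\pi}{N\alpha}\sum_{j\in J} w_ju_j\bar v_j$. Powers $\mathbf u^{\mathbf p}=(u_j^p)_j$ are entrywise, and $\mathrm{diag}(\mathbf v)$ is the diagonal matrix with diagonal $\mathbf v$. *)

(* Defs.v *)
From HB Require Import structures.
From mathcomp Require Import all_boot all_order all_algebra.
From mathcomp Require Import complex.
From mathcomp Require Import reals trigo.
From mathcomp Require Import ring.

Set Implicit Arguments.
Unset Strict Implicit.
Unset Printing Implicit Defensive.

Import Order.TTheory GRing.Theory Num.Theory.
Local Open Scope ring_scope.
Local Open Scope complex_scope.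

(* J = {-N/2, ..., N/2 - 1} is represented by 'I_N: the ordinal j stands for
   the integer j - N/2, and the node -N/2 is the ordinal of value 0. *)
Definition idx (N : nat) (j : 'I_N) : int := (j : nat)%:Z - (N./2)%:Z.

Definition boundary (N : nat) (j : 'I_N) : bool := idx j == - (N./2)%:Z.

(* The pair (0, 1), rather than the generic 'i of a numClosedFieldType, which is
   only specified up to conjugation. *)
Definition imag (R : realType) : R[i] := 0 +i* 1.

Definition expi (R : realType) (t : R) : R[i] := cos t +i* sin t.

Definition theta (R : realType) (N : nat) (j : 'I_N) : R :=
  2 * pi * (idx j)%:~R / N%:R.

(* At the boundary node, x_{-N/2} = -oo on paper, whereas tan (- (pi / 2)) is an
   arbitrary value here; it is never used, because every occurrence of
   [node] below is guarded by [boundary]. *)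
Definition node (R : realType) (alpha : R) (N : nat) (j : 'I_N) : R :=
  alpha * tan (theta R j / 2).

Definition Fmx (R : realType) (N : nat) : 'M[R[i]]_N :=
  \matrix_(k, j) (N%:R^-1 * expi (- ((idx k)%:~R * theta R j))).

Definition Finvmx (R : realType) (N : nat) : 'M[R[i]]_N :=
  \matrix_(j, k) expi ((idx k)%:~R * theta R j).

Definition Pmx (R : realType) (alpha : R) (N : nat) : 'M[R[i]]_N :=
  diag_mx (\row_j (if boundary j then 0 else alpha -i* node alpha j)).

(* Not [invmx (Pmx alpha N)]: the boundary entry of P is 0. *)
Definition Pinvmx (R : realType) (alpha : R) (N : nat) : 'M[R[i]]_N :=
  diag_mx (\row_j (if boundary j then 0 else (alpha -i* node alpha j)^-1)).

Definition Wmx (R : realType) (alpha : R) (N : nat) : 'M[R[i]]_N :=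
  diag_mx (\row_j (if boundary j then 0
                   else (alpha ^+ 2 + node alpha j ^+ 2)%:C)).

Lemma WmxE (R : realType) (alpha : R) (N : nat) :
  Wmx alpha N = Pmx alpha N *m map_mx conjc (Pmx alpha N).
Proof.
rewrite /Wmx /Pmx map_diag_mx mulmx_diag; congr diag_mx.
apply/rowP => j; rewrite !mxE; case: ifP => _; first by rewrite mul0r.
by congr (_ +i* _); rewrite /=; ring.
Qed.

(* Row k of the matrix has no entry for hat u_(k-1) or hat u_(k+1) when that
   index is outside J, which is the convention hat u_k := 0 for k \notin J. *)
Definition S1mx (R : realType) (alpha : R) (N : nat) : 'M[R[i]]_N :=
  \matrix_(k, l) (imag R / (2 * alpha)%:C *
    (if idx l == idx k - 1 then idx k
     else if idx l == idx k then 2 * idx k + 1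
     else if idx l == idx k + 1 then idx k + 1
     else 0)%:~R).

Definition S2mx (R : realType) (alpha : R) (N : nat) : 'M[R[i]]_N :=
  S1mx alpha N *m S1mx alpha N.

Definition Hmx (R : realType) (N : nat) : 'M[R[i]]_N :=
  - imag R *: diag_mx (\row_k (Num.sg ((idx k)%:~R + 2^-1 : R))%:C).

Definition dot_h (R : realType) (alpha : R) (N : nat)
    (u v : 'cV[R[i]]_N) : R[i] :=
  (pi / (N%:R * alpha))%:C *
  ((map_mx conjc v)^T *m Wmx alpha N *m u) ord0 ord0.

Definition mass_h (R : realType) (alpha : R) (N : nat)
    (u : 'cV[R[i]]_N) : R[i] := dot_h alpha u u.

Definition pow_vec (R : realType) (N : nat) (u : 'cV[R[i]]_N) (p : nat) :
    'cV[R[i]]_N := map_mx (fun z => z ^+ p) u.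

Definition real_grid_vector (R : realType) (N : nat)
    (u : 'cV[R[i]]_N) : Prop :=
  (forall j, exists x : R, u j ord0 = x%:C) /\
  (forall j, boundary j -> u j ord0 = 0).

Definition scheme (R : realType) (alpha tau : R) (N m : nat)
    (u0 u1 : 'cV[R[i]]_N) : Prop :=
  let uh : 'cV[R[i]]_N := 2^-1 *: (u0 + u1) in
  let P := Pmx alpha N in
  let Pinv := Pinvmx alpha N in
  let F := Fmx R N in
  let Finv := Finvmx R N in
  let S1 := S1mx alpha N in
  let S2 := S2mx alpha N in
  let H := Hmx R N in
  (tau%:C)^-1 *: (u1 - u0) =
    Pinv *m Finv *m H *m S2 *m F *m P *m uh
    - (m.+1)%:R^-1 *:
      (diag_mx (pow_vec uh (m - 1)%N)^T *m Pinv *m Finv *m S1 *m F *m P *m uh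
       + Pinv *m Finv *m S1 *m F *m P *m pow_vec uh m).

(* Main.v *)
Require Import Defs.
From mathcomp Require Import all_boot all_order all_algebra.
From mathcomp Require Import complex.
From mathcomp Require Import reals trigo.
From mathcomp Require Import lra zify.

Set Implicit Arguments.
Unset Strict Implicit.
Unset Printing Implicit Defensive.

Import Order.TTheory GRing.Theory Num.Theory.
Local Open Scope ring_scope.
Local Open Scope complex_scope.

(** Mass is conserved because the scheme, paired with the midpoint [uh] in the
    weighted inner product, equates a real number with a purely imaginary one.

    Real side: pairing [un1 - un] with [un1 + un] gives the difference of the
    two masses, since the cross terms cancel for real vectors.

    Imaginary side: for a matrix [A] acting on Fourier coefficients, the product
    of [W] and [P^-1] is the adjoint of [P], and [F^-1] is [N] times the adjoint
    of [F].  Hence [W P^-1 F^-1 A F P] is, up to the factor [N], a congruence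
    transform of [A] ([weighted_conjugateE]), and it is skew-Hermitian as soon
    as [A] is.
    - [S1] is [i] times a real symmetric matrix, hence skew-Hermitian
      ([S1mx_skew]); cutting the band off at the ends of [J] keeps the symmetry.
    - [S1] does not couple the modes [-1] and [0], across which the symbol
      of [H] jumps, so [H] commutes with [S1] ([Hmx_S1mxC]) and [H S2] is
      skew-Hermitian ([HS2_skew]); the dispersive term thus contributes an
      imaginary number.
    - Writing [B] for the transform of [S1] and [v] for the [m]-th power of
      [uh], the two halves of the nonlinear term contribute
      [v^* B uh + uh^* B v], which is again imaginary because [B] is
      skew-Hermitian.  This is what splitting the nonlinear term into an
      advective half and a conservative half achieves. *)

(** * Adjoints *)

(* Keeps conjugates of explicit scalars such as [imag R] folded under [/=]. *)
#[local] Arguments conjc : simpl never.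

Definition adjmx (R : realType) (p q : nat) (A : 'M[R[i]]_(p, q)) :
  'M[R[i]]_(q, p) := (map_mx conjc A)^T.

Section Adjoint.
Variable R : realType.
Implicit Types p q r : nat.

Lemma adjmxM p q r (A : 'M[R[i]]_(p, q)) (B : 'M[R[i]]_(q, r)) :
  adjmx (A *m B) = adjmx B *m adjmx A.
Proof. by rewrite /adjmx map_mxM trmx_mul. Qed.

Lemma adjmxD p q (A B : 'M[R[i]]_(p, q)) :
  adjmx (A + B) = adjmx A + adjmx B.
Proof. by rewrite /adjmx map_mxD linearD. Qed.

Lemma adjmxN p q (A : 'M[R[i]]_(p, q)) : adjmx (- A) = - adjmx A.
Proof. by rewrite /adjmx map_mxN linearN. Qed.

Lemma adjmxZ p q (a : R[i]) (A : 'M[R[i]]_(p, q)) :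
  adjmx (a *: A) = conjc a *: adjmx A.
Proof. by rewrite /adjmx map_mxZ linearZ. Qed.

Lemma adjmxK p q (A : 'M[R[i]]_(p, q)) : adjmx (adjmx A) = A.
Proof. by apply/matrixP => i j; rewrite !mxE conjcK. Qed.

Lemma conjc_realC (x : R) : conjc x%:C = x%:C.
Proof. by rewrite /conjc /= oppr0. Qed.

Lemma conjc_imag : conjc (imag R) = - imag R.
Proof. by rewrite /conjc /= /imag; congr (_ +i* _); rewrite oppr0. Qed.

(** For [u = v] the pairing is purely imaginary; for [u] and [v] distinct, the
    pairings [v^* B u] and [u^* B v] have a purely imaginary sum. *)
Lemma adjmx_form_skew p (B : 'M[R[i]]_p) (u v : 'cV[R[i]]_p) :
  adjmx B = - B -> adjmx (adjmx v *m B *m u) = - (adjmx u *m B *m v).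
Proof.
by move=> skewB; rewrite !adjmxM adjmxK skewB mulNmx mulmxN mulmxA.
Qed.

(** The pairings of the scheme with [uh]: dispersive term and the two halves of
    the nonlinear term, where [v] stands for a power of [uh]. *)
Lemma adjmx_energy_skew p (B1 B2 : 'M[R[i]]_p) (u v : 'cV[R[i]]_p) (a : R[i]) :
  adjmx B1 = - B1 -> adjmx B2 = - B2 -> conjc a = a ->
  let q := adjmx u *m B1 *m u
           - a *: (adjmx v *m B2 *m u + adjmx u *m B2 *m v) in
  adjmx q = - q.
Proof.
move=> skew1 skew2 real_a q; rewrite adjmxD adjmxN adjmxZ adjmxD real_a.
rewrite !adjmx_form_skew // /q -(opprD (adjmx u *m B2 *m v)).
by rewrite scalerN opprK opprB addrC [X in _ *: X - _]addrC.
Qed.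

(** The square of [S] is Hermitian and commutes with [A]. *)
Lemma adjmx_mul_sqr_skew p (A S : 'M[R[i]]_p) :
  adjmx A = - A -> adjmx S = - S -> A *m S = S *m A ->
  adjmx (A *m (S *m S)) = - (A *m (S *m S)).
Proof.
move=> skewA skewS commAS; rewrite !adjmxM skewA skewS !mulmxN !mulNmx opprK.
by rewrite -mulmxA -commAS !mulmxA -commAS.
Qed.

Lemma hermitian_skew_eq0 p (A : 'M[R[i]]_p) :
  adjmx A = A -> adjmx A = - A -> A = 0.
Proof.
move=> -> eqA; apply/matrixP => i j; move/matrixP/(_ i j)/eqP: eqA.
by rewrite !mxE -addr_eq0 -mulr2n mulrn_eq0 /= => /eqP.
Qed.

End Adjoint.

(** * The matrices of the scheme *)

Lemma sgr_int_half (R : realFieldType) (k : int) :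
  Num.sg (k%:~R + 2^-1 : R) = if 0 <= k then 1 else -1.
Proof.
case: ifP => k_ge0.
  by apply: gtr0_sg; rewrite ltr_wpDl ?invr_gt0 ?ltr0n // ler0z.
apply: ltr0_sg; have : (k + 1)%:~R <= 0 :> R by rewrite lerz0; lia.
by rewrite intrD; lra.
Qed.

Section Scheme.
Variables (R : realType) (alpha : R) (N : nat).

Lemma Finvmx_adj : (0 < N)%N -> Finvmx R N = N%:R *: adjmx (Fmx R N).
Proof.
move=> N_gt0; apply/matrixP => j k; rewrite !mxE rmorphM fmorphV rmorph_nat.
rewrite [RHS]mulrA divff ?pnatr_eq0 -?lt0n // mul1r /expi /= /conjc.
by rewrite cosN sinN opprK.
Qed.

(** Away from the boundary node this is [w / (alpha - i x) = alpha + i x]; at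
    that node both sides vanish. *)
Lemma Wmx_Pinvmx : 0 < alpha ->
  Wmx alpha N *m Pinvmx alpha N = adjmx (Pmx alpha N).
Proof.
move=> alpha_gt0; rewrite WmxE /adjmx /Pmx /Pinvmx map_diag_mx.
rewrite tr_diag_mx !mulmx_diag.
congr diag_mx; apply/rowP => j; rewrite !mxE; case: ifP => _.
  by rewrite !mul0r rmorph0.
rewrite mulrAC divff ?mul1r //.
by apply/eqP => -[alpha0]; move: alpha_gt0; rewrite alpha0 ltxx.
Qed.

(** The weight of the inner product turns the similarity-like action of [A] on
    grid vectors into a congruence, which preserves skew-symmetry. *)
Lemma weighted_conjugateE (A : 'M[R[i]]_N) : 0 < alpha -> (0 < N)%N ->
  Wmx alpha N *m Pinvmx alpha N *m Finvmx R N *m A *m Fmx R N *m Pmx alpha N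
  = N%:R *: (adjmx (Fmx R N *m Pmx alpha N) *m A *m (Fmx R N *m Pmx alpha N)).
Proof.
move=> alpha_gt0 N_gt0; rewrite Wmx_Pinvmx // Finvmx_adj // adjmxM.
by rewrite -scalemxAr -!scalemxAl !mulmxA.
Qed.

Lemma weighted_conjugate_skew (A : 'M[R[i]]_N) : 0 < alpha -> (0 < N)%N ->
  adjmx A = - A ->
  let B := Wmx alpha N *m Pinvmx alpha N *m Finvmx R N *m A *m Fmx R N
           *m Pmx alpha N in
  adjmx B = - B.
Proof.
move=> alpha_gt0 N_gt0 skewA; rewrite /= weighted_conjugateE //.
move: (Fmx R N *m Pmx alpha N) => X.
rewrite adjmxZ rmorph_nat !adjmxM adjmxK skewA.
by rewrite mulNmx mulmxN mulmxA scalerN.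
Qed.

(** The row and column neighbours agree: entry [(k, k - 1)] is [k], and entry
    [(k - 1, k)] is [(k - 1) + 1]. *)
Lemma S1mx_skew : adjmx (S1mx alpha N) = - S1mx alpha N.
Proof.
apply/matrixP => k l; rewrite !mxE 2!rmorphM fmorphV rmorph_int /=.
rewrite conjc_imag conjc_realC !mulNr; congr (- (_ * _%:~R)).
by move: (idx k) (idx l) => a b; do ![case: eqP => ?]; lia.
Qed.

(** The symbol of [H] changes sign only between the modes [-1] and [0], and
    there the off-diagonal entries of [S1] are zero. *)
Lemma Hmx_S1mxC : Hmx R N *m S1mx alpha N = S1mx alpha N *m Hmx R N.
Proof.
rewrite /Hmx -scalemxAl -scalemxAr; congr (_ *: _).
apply/matrixP => k l; rewrite mul_diag_mx mul_mx_diag !mxE !sgr_int_half.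
rewrite mulrC -!mulrA; congr (_ * (_ * _)).
move: (idx k) (idx l) => a b.
case: (0 <= a) / boolP => a_ge0; case: (0 <= b) / boolP => b_ge0 //.
all: suff -> : (if b == a - 1 then a else if b == a then 2 * a + 1
            else if b == a + 1 then a + 1 else 0) = 0 by rewrite !mul0r.
all: do ![case: eqP => ?]; lia.
Qed.

Lemma Hmx_skew : adjmx (Hmx R N) = - Hmx R N.
Proof.
rewrite /Hmx adjmxZ rmorphN /= conjc_imag -scaleNr; congr (_ *: _).
rewrite /adjmx map_diag_mx tr_diag_mx; congr diag_mx.
by apply/rowP => k; rewrite !mxE /= conjc_realC.
Qed.

Lemma HS2_skew :
  adjmx (Hmx R N *m S2mx alpha N) = - (Hmx R N *m S2mx alpha N).
Proof.
apply: adjmx_mul_sqr_skew; first exact: Hmx_skew.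
  exact: S1mx_skew.
exact: Hmx_S1mxC.
Qed.

(** Moving the pointwise factor [u^(m-1)] across the real weight merges it with
    [u^*] into [(u^m)^*]. *)
Lemma adjmx_W_diag_pow (u : 'cV[R[i]]_N) (m : nat) : (0 < m)%N ->
  map_mx conjc u = u ->
  adjmx u *m Wmx alpha N *m diag_mx (pow_vec u (m - 1)%N)^T
  = adjmx (pow_vec u m) *m Wmx alpha N.
Proof.
case: m => // m _ real_u; rewrite subn1 /=.
apply/matrixP => i j; rewrite /Wmx !mul_mx_diag !mxE rmorphXn /=.
have -> : conjc (u j i) = u j i.
  by move/matrixP/(_ j i): real_u; rewrite mxE.
by rewrite (ord1 i) [u j 0 ^+ m.+1]exprS mulrAC.
Qed.

(** Polarization: the cross terms cancel because the weighted form is symmetric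
    on real vectors. *)
Lemma weighted_form_diff (u v : 'cV[R[i]]_N) :
  map_mx conjc u = u -> map_mx conjc v = v ->
  adjmx (u + v) *m Wmx alpha N *m (v - u)
  = adjmx v *m Wmx alpha N *m v - adjmx u *m Wmx alpha N *m u.
Proof.
move=> real_u real_v; rewrite adjmxD !mulmxDl !mulmxDr !mulmxN.
have -> : adjmx u *m Wmx alpha N *m v = adjmx v *m Wmx alpha N *m u.
  rewrite /adjmx real_u real_v -[LHS]trmxK; apply/matrixP => i j.
  by rewrite mxE !ord1 2!trmx_mul trmxK tr_diag_mx mulmxA.
by rewrite addrC subrKA.
Qed.

End Scheme.

Lemma real_grid_conj (R : realType) (N : nat) (u : 'cV[R[i]]_N) :
  real_grid_vector u -> map_mx conjc u = u.
Proof.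
case=> real_u _; apply/colP => j; rewrite mxE.
by have [x ->] := real_u j; rewrite conjc_realC.
Qed.

Theorem theorem3p1 (R : realType) (alpha tau : R) (N m : nat)
    (un un1 : 'cV[R[i]]_N)
    (alpha_gt0 : 0 < alpha) (tau_gt0 : 0 < tau)
    (N_gt0 : (0 < N)%N) (N_even : ~~ odd N) (m_ge1 : (1 <= m)%N)
    (un_grid : real_grid_vector un) (un1_grid : real_grid_vector un1)
    (un_scheme : scheme alpha tau m un un1) :
  mass_h alpha un1 = mass_h alpha un.
Proof.
have real0 := real_grid_conj un_grid; have real1 := real_grid_conj un1_grid.
move: un_scheme; rewrite /scheme /=; set uh := 2^-1 *: (un + un1) => eq_scheme.
have conj_half : conjc (2^-1 : R[i]) = 2^-1 by rewrite fmorphV rmorph_nat.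
have real_h : map_mx conjc uh = uh.
  by rewrite /uh map_mxZ map_mxD real0 real1 /= conj_half.
pose W := Wmx alpha N.
pose g : 'M_1 := adjmx un1 *m W *m un1 - adjmx un *m W *m un.
have adjW : adjmx W = W.
  rewrite /W WmxE -[map_mx _ _]trmxK -/(adjmx _) /Pmx /adjmx map_diag_mx.
  rewrite !tr_diag_mx !mulmx_diag map_diag_mx tr_diag_mx; congr diag_mx.
  by apply/rowP => j; rewrite !mxE rmorphM /= conjcK mulrC.
have herm_g : adjmx g = g.
  by rewrite adjmxD adjmxN !adjmxM !adjmxK adjW !mulmxA.
pose c : R[i] := (tau%:C)^-1 * 2^-1.
have gE : adjmx uh *m W *m ((tau%:C)^-1 *: (un1 - un)) = c *: g.
  rewrite /uh adjmxZ conj_half -scalemxAr -!scalemxAl scalerA.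
  by rewrite weighted_form_diff.
clearbody uh.
have c_real : conjc c = c.
  by rewrite /c rmorphM fmorphV /= conjc_realC conj_half.
have c_neq0 : c != 0.
  rewrite mulf_neq0 ?invr_eq0 ?pnatr_eq0 //.
  by apply/eqP => -[tau0]; move: tau_gt0; rewrite tau0 ltxx.
have skew_g : adjmx (c *: g) = - (c *: g).
  pose B A := W *m Pinvmx alpha N *m Finvmx R N *m A *m Fmx R N *m Pmx alpha N.
  pose B1 := B (Hmx R N *m S2mx alpha N); pose B2 := B (S1mx alpha N).
  have skew1 : adjmx B1 = - B1 by exact/weighted_conjugate_skew/HS2_skew.
  have skew2 : adjmx B2 = - B2 by exact/weighted_conjugate_skew/S1mx_skew.
  have -> : c *: g = adjmx uh *m B1 *m uh - m.+1%:R^-1 *: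
      (adjmx (pow_vec uh m) *m B2 *m uh + adjmx uh *m B2 *m pow_vec uh m).
    have pow_cross := adjmx_W_diag_pow alpha m_ge1 real_h.
    (* Opaque matrices keep unification from unfolding [Hmx] and [S2mx]. *)
    rewrite -gE eq_scheme /B1 /B2 /B /W; move: pow_cross.
    move: (Wmx _ _) (diag_mx _) (Pinvmx _ _) (Finvmx _ _) (Hmx _ _)
      (S1mx _ _) (S2mx _ _) (Fmx _ _) (Pmx _ _)
      => W' D Pinv Finv H S1 S2 F P pow_cross.
    by rewrite mulmxBr -scalemxAr mulmxDr !mulmxA pow_cross.
  by clearbody B1 B2; apply: adjmx_energy_skew; rewrite // fmorphV rmorph_nat.
have : c *: g = 0.
  by apply: hermitian_skew_eq0 skew_g; rewrite adjmxZ c_real herm_g.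
move/eqP; rewrite scaler_eq0 (negPf c_neq0) /= subr_eq0 => /eqP eq_mass.
by rewrite /mass_h /dot_h -!/(adjmx _) eq_mass.
Qed.
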